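(* Let $T$ be an h-inductive theory in a language $L$ and let $x$ be a finite tuple of variables. The spectral topology on $S_x(T)$ is Hausdorff and finer than the definable topology on $S_x(T)$.
   Context: $L$ is a many-sorted first-order language containing two $0$-ary relation symbols $\top$ (true) and $\bot$ (false), interpreted in the obvious way. The notation $\phi(x)$ means that the free variables of $\phi$ are among the finite tuple $x$. A positive formula is a finitary formula built from atomic formulas using only finite conjunctions, finite disjunctions and existential quantifications; $L^+$ is the set of positive formulas. An h-inductive sentence is a finite conjunction of sentences of the form $\forall x\,(\phi(x)\Rightarrow\psi(x))$ with $\phi,\psi$ positive; an h-inductive theory is a set of h-inductive sentences. A positive type of $T$ in variables $x$ is a set $p$ of positive formulas $\phi(x)$ such that $T\cup p(x)$ is consistent (i.e. $p$ is satisfied by some tuple in some model of $T$) and $p$ is maximal with this property. $S_x(T)$ is the set of all such positive types. For $\phi(x)\in L^+$ put $[\phi]=\{p\in S_x(T):\phi\in p\}$. The definable topology on $S_x(T)$ is the topology for which the sets $[\phi]$, $\phi(x)\in L^+$, form a basis of closed sets. The spectral topology on $S_x(T)$ is the topology for which the sets $[\phi]$, $\phi(x)\in L^+$, form a basis of open sets. *)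

(* Defs.v *)
From HB Require Import structures.
From mathcomp Require Import all_boot.
From mathcomp Require Import boolp classical_sets topology.

Set Implicit Arguments.
Unset Strict Implicit.
Unset Printing Implicit Defensive.

Local Open Scope classical_set_scope.

(** * Many-sorted languages and structures *)

(* Equality on every sort and the 0-ary relation symbols top and bot, whose
   interpretation is the same in all structures, are not recorded here: they
   are constructors of [atomic] below. *)
Record language := Language {
  sort_of : Type;
  func_of : Type;
  func_dom : func_of -> seq sort_of;
  func_cod : func_of -> sort_of;
  rel_of : Type;
  rel_dom : rel_of -> seq sort_of }.

(* [var x s] is the type of positions of sort [s] in the list of sorts [x].
   A finite tuple of variables is given by the list [x] of their sorts, so
   variables are well-sorted de Bruijn indices. *)
Inductive var (S : Type) : seq S -> S -> Type :=
| VarZ x s : var (s :: x) s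
| VarS x s s' : var x s -> var (s' :: x) s.

(* Tuples (a_1, ..., a_n) with a_i in [A s_i], where [x = [:: s_1; ...; s_n]]. *)
Definition tup (S : Type) (A : S -> Type) (x : seq S) : Type :=
  forall s, var x s -> A s.

Definition tup_cons (S : Type) (A : S -> Type) (x : seq S) (s : S)
    (b : A s) (a : tup A x) : tup A (s :: x) :=
  fun s' v =>
    match v in var y t return
      match y with
      | [::] => unit
      | s0 :: y0 => A s0 -> tup A y0 -> A t
      end
    with
    | VarZ _ _ => fun b _ => b
    | VarS _ t _ w => fun _ a => a t w
    end b a.

(* Carriers may be empty. This is the more general convention: that the sort
   [s] is inhabited is the h-inductive sentence [inhabited_sort s] below. *)
Record structure (L : language) := Structure {
  carrier :> sort_of L -> Type;
  func_interp : forall f : func_of L, tup carrier (func_dom f) -> carrier (func_cod f);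
  rel_interp : forall r : rel_of L, tup carrier (rel_dom r) -> Prop }.

(** * Positive formulas *)

Section Syntax.
Variable L : language.

Inductive term (x : seq (sort_of L)) : sort_of L -> Type :=
| Var s : var x s -> term x s
| App (f : func_of L) :
    (forall s, var (func_dom f) s -> term x s) -> term x (func_cod f).

Inductive atomic (x : seq (sort_of L)) : Type :=
| PTop
| PBot
| PEq s (t u : term x s)
| PRel (r : rel_of L) (t : tup (term x) (rel_dom r)).

(* [pformula x] is the set of positive formulas phi(x). *)
Inductive pformula : seq (sort_of L) -> Type :=
| PAtom x : atomic x -> pformula x
| PAnd x : pformula x -> pformula x -> pformula x
| POr x : pformula x -> pformula x -> pformula x
| PEx x s : pformula (s :: x) -> pformula x.

Inductive hsentence : Type :=
| HForall x (phi psi : pformula x)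
| HAnd (sigma tau : hsentence).

Definition htheory := set hsentence.

Definition inhabited_sort (s : sort_of L) : hsentence :=
  HForall (PAtom (PTop [::])) (PEx (PAtom (PTop [:: s]))).

End Syntax.

Arguments PTop {L x}.
Arguments PBot {L x}.

(** * Satisfaction *)

Section Semantics.
Variables (L : language) (M : structure L).

Fixpoint eval (x : seq (sort_of L)) (a : tup M x) s (t : term x s) : M s :=
  match t with
  | Var s v => a s v
  | App f ts => func_interp (fun s v => eval a (ts s v))
  end.

Definition sat_atomic (x : seq (sort_of L)) (a : tup M x) (phi : atomic x) : Prop :=
  match phi with
  | PTop => True
  | PBot => False
  | PEq s t u => eval a t = eval a u
  | PRel r ts => rel_interp (fun s v => eval a (ts s v))
  end.

Fixpoint sat (x : seq (sort_of L)) (phi : pformula x) : tup M x -> Prop :=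
  match phi with
  | PAtom _ alpha => fun a => sat_atomic a alpha
  | PAnd _ phi psi => fun a => sat phi a /\ sat psi a
  | POr _ phi psi => fun a => sat phi a \/ sat psi a
  | PEx _ s phi => fun a => exists b : M s, sat phi (tup_cons b a)
  end.

Fixpoint hsat (sigma : hsentence L) : Prop :=
  match sigma with
  | HForall x phi psi => forall a : tup M x, sat phi a -> sat psi a
  | HAnd sigma tau => hsat sigma /\ hsat tau
  end.

Definition models (T : htheory L) : Prop := forall sigma, T sigma -> hsat sigma.

Lemma hsat_inhabited_sort (s : sort_of L) :
  hsat (inhabited_sort s) <-> inhabited (M s).
Proof.
split=> [h|[b] a _]; last by exists b.
have a : tup M [::] by move=> s' v; inversion v.
by have [b _] := h a I; exists.
Qed.

End Semantics.

(** * Positive types *)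

Section Types.
Variables (L : language) (T : htheory L) (x : seq (sort_of L)).

Definition consistent (p : set (pformula x)) : Prop :=
  exists M : structure L, models M T /\
  exists a : tup M x, forall phi, p phi -> sat phi a.

Definition is_positive_type (p : set (pformula x)) : Prop :=
  consistent p /\ forall q, consistent q -> p `<=` q -> q = p.

Record ptype := PType {
  ptype_set : set (pformula x);
  ptypeP : is_positive_type ptype_set }.

Definition basic (phi : pformula x) : set ptype := [set p : ptype | ptype_set p phi].

Lemma ptype_realized (p : ptype) : exists M : structure L, models M T /\
  exists a : tup M x, forall phi, ptype_set p phi <-> sat phi a.
Proof.
have [[M [MT [a pa]]] pmax] := ptypeP p.
exists M; split=> //; exists a => phi; split=> [/pa//|aphi].
rewrite -(pmax [set psi | sat psi a]) //; first by exists M; split=> //; exists a.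
Qed.

Lemma basicT : basic (PAtom PTop) = setT.
Proof.
by apply/seteqP; split=> // p _; have [M [_ [a pa]]] := ptype_realized p; apply/pa.
Qed.

Lemma basic0 : basic (PAtom PBot) = set0.
Proof.
by apply/seteqP; split=> // p; have [M [_ [a pa]]] := ptype_realized p; move/pa.
Qed.

Lemma basicI phi psi : basic (PAnd phi psi) = basic phi `&` basic psi.
Proof.
apply/seteqP; split=> p; have [M [_ [a pa]]] := ptype_realized p.
  by move=> /pa[? ?]; split; apply/pa.
by move=> [/pa ? /pa ?]; apply/pa.
Qed.

Lemma basicU phi psi : basic (POr phi psi) = basic phi `|` basic psi.
Proof.
apply/seteqP; split=> p; have [M [_ [a pa]]] := ptype_realized p.
  by move=> /pa[?|?]; [left|right]; apply/pa.
by move=> [/pa ?|/pa ?]; apply/pa; [left|right].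
Qed.

(** * The definable and the spectral topologies *)

Definition spectral_open (U : set ptype) : Prop :=
  exists D : set (pformula x), U = \bigcup_(phi in D) basic phi.

Definition definable_closed (C : set ptype) : Prop :=
  exists D : set (pformula x), C = \bigcap_(phi in D) basic phi.

Definition definable_open (U : set ptype) : Prop := definable_closed (~` U).

Lemma spectral_openT : spectral_open setT.
Proof. by exists [set PAtom PTop]; rewrite bigcup_set1 basicT. Qed.

Lemma spectral_openI : setI_closed spectral_open.
Proof.
move=> _ _ [D ->] [E ->].
exists [set chi | exists phi psi, [/\ D phi, E psi & chi = PAnd phi psi]].
apply/seteqP; split=> p.
  move=> [[phi Dphi pphi] [psi Epsi ppsi]]; exists (PAnd phi psi).
    by exists phi, psi.
  by rewrite basicI.
move=> [_ [phi [psi [Dphi Epsi ->]]]]; rewrite basicI => -[pphi ppsi].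
by split; [exists phi|exists psi].
Qed.

Lemma spectral_open_bigU (I : Type) (f : I -> set ptype) :
  (forall i, spectral_open (f i)) -> spectral_open (\bigcup_i f i).
Proof.
move=> fo; exists [set phi | exists i, basic phi `<=` f i].
apply/seteqP; split=> p; last by move=> [phi [i si] /si fp]; exists i.
move=> [i _]; have [D fE] := fo i; rewrite {1}fE => -[phi Dphi pphi].
by exists phi => //; exists i; rewrite fE => q qphi; exists phi.
Qed.

Lemma definable_openT : definable_open setT.
Proof. by exists [set PAtom PBot]; rewrite setCT bigcap_set1 basic0. Qed.

Lemma definable_openI : setI_closed definable_open.
Proof.
move=> U V [D UE] [E VE].
exists [set chi | exists phi psi, [/\ D phi, E psi & chi = POr phi psi]].
rewrite setCI UE VE; apply/seteqP; split=> p.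
  move=> pDE _ [phi [psi [Dphi Epsi ->]]]; rewrite basicU.
  by case: pDE => h; [left|right]; apply: h.
move=> h; rewrite /setU /=; apply/not_notP => /not_orP[].
move=> /existsNP[phi /not_implyP[Dphi nphi]].
move=> /existsNP[psi /not_implyP[Epsi npsi]].
have : basic (POr phi psi) p by apply: h; exists phi, psi.
by rewrite basicU => -[].
Qed.

Lemma definable_open_bigU (I : Type) (f : I -> set ptype) :
  (forall i, definable_open (f i)) -> definable_open (\bigcup_i f i).
Proof.
move=> fo; exists [set phi | exists i, ~` f i `<=` basic phi].
rewrite setC_bigcup; apply/seteqP; split=> p.
  by move=> h phi [i si]; apply/si/h.
move=> h i _; have [D fE] := fo i; rewrite fE => phi Dphi.
by apply: h; exists i; rewrite fE => q; apply.
Qed.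

End Types.

(* Two copies of S_x(T), each carrying one of the two topologies. *)
Definition spectral_space (L : language) (T : htheory L) (x : seq (sort_of L)) : Type :=
  ptype T x.

Definition definable_space (L : language) (T : htheory L) (x : seq (sort_of L)) : Type :=
  ptype T x.

HB.instance Definition _ (L : language) (T : htheory L) (x : seq (sort_of L)) :=
  gen_eqMixin (spectral_space T x).
HB.instance Definition _ (L : language) (T : htheory L) (x : seq (sort_of L)) :=
  gen_choiceMixin (spectral_space T x).
HB.instance Definition _ (L : language) (T : htheory L) (x : seq (sort_of L)) :=
  isOpenTopological.Build (spectral_space T x)
    (@spectral_openT L T x) (@spectral_openI L T x) (@spectral_open_bigU L T x).

HB.instance Definition _ (L : language) (T : htheory L) (x : seq (sort_of L)) :=
  gen_eqMixin (definable_space T x).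
HB.instance Definition _ (L : language) (T : htheory L) (x : seq (sort_of L)) :=
  gen_choiceMixin (definable_space T x).
HB.instance Definition _ (L : language) (T : htheory L) (x : seq (sort_of L)) :=
  isOpenTopological.Build (definable_space T x)
    (@definable_openT L T x) (@definable_openI L T x) (@definable_open_bigU L T x).

Lemma spectral_openE (L : language) (T : htheory L) (x : seq (sort_of L)) :
  (open : set (set (spectral_space T x))) = @spectral_open L T x.
Proof. by []. Qed.

Lemma definable_openE (L : language) (T : htheory L) (x : seq (sort_of L)) :
  (open : set (set (definable_space T x))) = @definable_open L T x.
Proof. by []. Qed.

(* Main.v *)
Require Import Defs.
From mathcomp Require Import all_boot.
From mathcomp Require Import boolp classical_sets topology.

(** Everything rests on one separation property: if a positive type [p] omits
[phi], then some [psi] in [p] satisfies [[phi] `&` [psi] = set0]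
([ptype_exclusion]). Indeed [p] together with [phi] is inconsistent with [T]
by maximality of [p]; by compactness finitely many members of [p] already
contradict [phi], and [psi] is their conjunction.

Given this, the complement of [[phi]] is the union of the [[psi]] disjoint
from it, hence it is spectrally open. The basic closed sets of the definable
topology are thus spectrally clopen, so the spectral topology is finer. It is
Hausdorff because, for [p != q], maximality yields [phi] in [p] and not in [q],
and then [[phi]] and a [[psi]] provided by the separation property for [q] are
disjoint neighbourhoods of [p] and [q].

The content is therefore the compactness theorem for positive formulas relative
to an h-inductive theory. It is proved with ultraproducts. Since sorts may be
empty, and different sorts may be empty in different factors, the product of the
factors may be empty even when the ultraproduct should not be; its elements are
germs of partial choice functions whose domain is large. Los's theorem for
positive formulas ([uprod_sat]) shows that h-inductive sentences true in every
factor are true in the ultraproduct ([uprod_hsat]). *)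

Set Implicit Arguments.
Unset Strict Implicit.
Unset Printing Implicit Defensive.

Local Open Scope classical_set_scope.
Local Open Scope quotient_scope.

(** * Tuples of variables *)

(** Inversion on [var (s0 :: x) s] as an elimination rule: an ordinary [case]
fails because the sort [s] is an index depending on the position. *)
Lemma var_consP (S : Type) (x : seq S) (s0 : S)
    (P : forall s, var (s0 :: x) s -> Prop) :
  P s0 (VarZ x s0) -> (forall s (v : var x s), P s (VarS s0 v)) ->
  forall s v, P s v.
Proof.
move=> PZ PS s v.
exact: (match v in var y t return
          match y return var y t -> Prop with
          | [::] => fun=> True
          | s1 :: y1 => fun w => forall Q : forall s, var (s1 :: y1) s -> Prop,
              Q s1 (VarZ y1 s1) -> (forall s (v : var y1 s), Q s (VarS s1 v)) ->
              Q t w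
          end v
        with
        | VarZ y t => fun Q QZ _ => QZ
        | VarS y t s' w => fun Q _ QS => QS t w
        end P PZ PS).
Qed.

(** A tuple of variables has finitely many positions, so this is closure of a
filter under finite intersections; it lets componentwise facts that hold almost
everywhere be used for all components at once. *)
Lemma filter_forall_var (S I : Type) (F : set_system I) (FF : Filter F)
    (x : seq S) (A : forall s, var x s -> set I) :
  (forall s (v : var x s), F (A s v)) -> F [set i | forall s v, A s v i].
Proof.
elim: x A => [|s0 x IHx] A FA.
  by apply: (filterS _ filterT) => i _ s v; inversion v.
have FAS := IHx (fun s v => A s (VarS s0 v)) (fun s v => FA s _).
apply: (filterS _ (filterI (FA s0 (VarZ x s0)) FAS)) => i [AZ AS] s v.
by move: s v; apply: var_consP.
Qed.

(** * Ultraproducts *)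

Section Ultraproduct.
Variables (L : language) (I : Type) (F : set_system I).
Hypothesis UF : UltraFilter F.
Variable M : I -> structure L.

(** Large partial functions instead of points of the full product, which is empty
as soon as one factor has no element of sort [s]. *)
Definition partial_element (s : sort_of L) : Type :=
  {f : forall i, option (M i s) | F [set i | f i]}.

Definition germ_eq s : rel {classic partial_element s} :=
  fun f g => `[< F [set i | sval f i = sval g i] >].

Lemma germ_eq_equiv s : equiv_class_of (@germ_eq s).
Proof.
split=> [f|f g|g f h].
- by apply/asboolP; apply: (filterS _ filterT).
- by apply/asboolP/asboolP; apply: filterS => i /esym.
- move=> /asboolP fg /asboolP gh; apply/asboolP.
  by apply: (filterS _ (filterI fg gh)) => i [/= -> ->].
Qed.

Canonical germ_eq_equiv_rel s := EquivRelPack (@germ_eq_equiv s).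

Definition germ (s : sort_of L) : Type := {eq_quot germ_eq_equiv_rel s}.

(** The value at [i] of a chosen representative of the germ: it is meaningful
only up to a negligible set of indices, and may be [None] on such a set. *)
Definition value s (c : germ s) (i : I) : option (M i s) :=
  sval (repr (c : {eq_quot germ_eq_equiv_rel s})) i.

Lemma value_defined s (c : germ s) : F [set i | value c i].
Proof. exact: (svalP (repr (c : {eq_quot germ_eq_equiv_rel s}))). Qed.

Lemma value_inj s (c d : germ s) : F [set i | value c i = value d i] -> c = d.
Proof.
move=> cd; rewrite -[c]reprK -[d]reprK; apply/eqmodP.
exact/asboolP.
Qed.

(** The only way elements of the ultraproduct are produced below: function values,
witnesses of existential quantifiers and the tuple realizing a finitely
satisfiable set are all choices of witnesses in almost every factor. *)
Lemma near_germ s (P : forall i, M i s -> Prop) :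
  F [set i | exists m, P i m] ->
  exists c : germ s, F [set i | exists2 m, value c i = Some m & P i m].
Proof.
move=> FP.
pose f i := if pselect (exists m, P i m) is left h then Some (projT1 (cid h)) else None.
have fP i : (exists m, P i m) -> exists2 m, f i = Some m & P i m.
  by rewrite /f; case: pselect => // h _; exists (projT1 (cid h)) => //; exact: projT2.
have Ff : F [set i | f i].
  by apply: (filterS _ FP) => i /fP[m fi _]; rewrite /= fi.
pose g : {classic partial_element s} := exist _ f Ff.
pose c := \pi_({eq_quot germ_eq_equiv_rel s}) g.
have /eqmodP/asboolP vf : repr c = g %[mod_eq germ_eq_equiv_rel s] by rewrite reprK.
exists c; apply: (filterS _ (filterI vf FP)) => i [/= vfi /fP[m fi Pm]].
by exists m => //; rewrite /value vfi.
Qed.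

(** [b] is the coordinate at [i] of the tuple [a] of germs. It is a relation, not a
function of [i], since some component of [a] may have no value at [i]; it is
functional ([represents_inj]) and defined almost everywhere
([near_represents]). *)
Definition represents x (i : I) (a : tup germ x) (b : tup (M i) x) : Prop :=
  forall s v, value (a s v) i = Some (b s v).

Lemma represents_inj x i (a : tup germ x) (b b' : tup (M i) x) :
  represents a b -> represents a b' -> b = b'.
Proof.
move=> ab ab'; apply: functional_extensionality_dep => s.
apply: functional_extensionality_dep => v.
by apply: Some_inj; rewrite -ab ab'.
Qed.

Lemma represents_cons x i (a : tup germ x) (b : tup (M i) x) s c m :
  value c i = Some m -> represents a b ->
  represents (tup_cons c a) (tup_cons (s := s) m b).
Proof. by move=> cm ab; apply: var_consP. Qed.

Lemma near_represents x (a : tup germ x) :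
  F [set i | exists b : tup (M i) x, represents a b].
Proof.
elim: x a => [|s0 x IHx] a.
  apply: (filterS _ filterT) => i _.
  have b : tup (M i) [::] by move=> s v; inversion v.
  by exists b => s v; inversion v.
have Fb := IHx (fun s v => a s (VarS s0 v)).
apply: (filterS _ (filterI (value_defined (a s0 (VarZ x s0))) Fb)) => i [].
rewrite /=; case am: value => [m|//] _ [b ab].
by exists (tup_cons m b); apply: var_consP.
Qed.

Definition uprod_func_spec (f : func_of L) (a : tup germ (func_dom f))
    (c : germ (func_cod f)) : Prop :=
  F [set i | exists2 b : tup (M i) (func_dom f),
       represents a b & value c i = Some (func_interp b)].

Lemma uprod_func_ex (f : func_of L) (a : tup germ (func_dom f)) :
  exists c, uprod_func_spec a c.
Proof.
have : F [set i | exists m, exists2 b : tup (M i) (func_dom f),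
    represents a b & func_interp b = m].
  by apply: (filterS _ (near_represents a)) => i [b ab]; exists (func_interp b), b.
move=> /near_germ[c cP]; exists c; apply: (filterS _ cP) => i [m cm [b ab bm]].
by exists b => //; rewrite cm bm.
Qed.

Definition uprod : structure L :=
  @Structure L germ
    (fun f a => projT1 (cid (uprod_func_ex a)))
    (fun r a => F [set i | exists2 b : tup (M i) (rel_dom r),
                     represents a b & rel_interp b]).

Lemma value_eval x (a : tup uprod x) s (t : term x s) :
  F [set i | forall b : tup (M i) x, represents a b ->
       value (Defs.eval a t) i = Some (Defs.eval b t)].
Proof.
elim: t => [s' v|f ts IHts] /=; first by apply: (filterS _ filterT) => i _ b; apply.
case: cid => c /= cP.
apply: (filterS _ (filterI (filter_forall_var _ IHts) cP)) => i [IH [b' ab' cb']] b ab.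
by rewrite [LHS]cb'; congr (Some (func_interp _)); apply: (represents_inj ab') => s' v; apply: IH.
Qed.

Definition sat_at x (phi : pformula x) (a : tup uprod x) : set I :=
  [set i | exists2 b : tup (M i) x, represents a b & sat phi b].

(** Los's theorem. Disjunction is the case where [F] has to be an ultrafilter;
existential quantification is [near_germ], and equality is [value_inj]. *)
Lemma uprod_sat x (phi : pformula x) (a : tup uprod x) :
  sat phi a <-> F (sat_at phi a).
Proof.
elim: phi a => {x} [x [||s t u|r ts]|x phi IHphi psi IHpsi|x phi IHphi psi IHpsi
  |x s phi IHphi] a /=.
- split=> // _; apply: (filterS _ (near_represents a)) => i [b ab].
  by exists b.
- by split=> // F0; apply: (filter_not_empty F); apply: (filterS _ F0) => i [].
- have Ftu : F [set i | forall b : tup (M i) x, represents a b ->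
      value (Defs.eval a t) i = Some (Defs.eval b t) /\
      value (Defs.eval a u) i = Some (Defs.eval b u)].
    apply: (filterS _ (filterI (value_eval a t) (value_eval a u))) => i [ti ui] b ab.
    by rewrite (ti b ab) (ui b ab).
  split=> [tu|Fb].
    apply: (filterS _ (filterI Ftu (near_represents a))) => i [tui [b ab]].
    have [ti ui] := tui b ab.
    by exists b => //=; apply: Some_inj; rewrite -ti -ui tu.
  apply: value_inj; apply: (filterS _ (filterI Ftu Fb)) => i [tui [b ab /= tu]] /=.
  by have [-> ->] := tui b ab; rewrite tu.
- have Fts : F [set i | forall s (v : var (rel_dom r) s) (b : tup (M i) x),
      represents a b ->
      value (Defs.eval a (ts s v)) i = Some (Defs.eval b (ts s v))].
    exact: (filter_forall_var _ (fun s v => value_eval a (ts s v))).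
  split=> H.
    apply: (filterS _ (filterI (filterI Fts (near_represents a)) H)).
    move=> i [[tsi [b ab]] [c tc rc]]; exists b => //=.
    suff -> : (fun s v => Defs.eval b (ts s v)) = c by [].
    by apply: (represents_inj _ tc) => s v; apply: tsi.
  apply: (filterS _ (filterI Fts H)) => i [tsi [b ab rb]].
  by exists (fun s v => Defs.eval b (ts s v)) => // s v; apply: tsi.
- split=> [[/IHphi Fphi /IHpsi Fpsi]|Fpp].
    apply: (filterS _ (filterI Fphi Fpsi)) => i [[b ab bphi] [b' ab' bpsi]].
    by exists b => //; split=> //; rewrite (represents_inj ab ab').
  by split; [apply/IHphi|apply/IHpsi]; apply: (filterS _ Fpp) => i [b ab []]; exists b.
- split=> [[/IHphi|/IHpsi]|Fpp].
  + by apply: filterS => i [b ab bphi]; exists b => //; left.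
  + by apply: filterS => i [b ab bphi]; exists b => //; right.
  (* When [phi] is not true almost everywhere, its failure is, and [psi] takes over. *)
  have [|nphi] := in_ultra_setVsetC (sat_at phi a) UF; first by left; apply/IHphi.
  right; apply/IHpsi; apply: (filterS _ (filterI nphi Fpp)) => i [nb [b ab [bphi|bpsi]]].
    by case: nb; exists b.
  by exists b.
- split=> [[c /IHphi Fc]|Fex].
    apply: (filterS _ (filterI Fc (near_represents a))) => i [[b cab bphi] [b' ab']].
    exists b' => //; exists (b s (VarZ x s)).
    suff <- : b = tup_cons (b s (VarZ x s)) b' by [].
    by apply: (represents_inj cab); apply: represents_cons => //; exact: (cab s (VarZ x s)).
  have : F [set i | exists m, exists2 b : tup (M i) x,
      represents a b & sat phi (tup_cons (s := s) m b)].
    by apply: (filterS _ Fex) => i [b ab [m mphi]]; exists m, b.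
  move=> /near_germ[c Fc]; exists c; apply/IHphi.
  apply: (filterS _ Fc) => i [m cm [b ab bphi]].
  by exists (tup_cons m b) => //; apply: represents_cons.
Qed.

(** Both sides of an implication of positive formulas are transferred by
[uprod_sat], so the implication survives in the ultraproduct. *)
Lemma uprod_hsat (sigma : hsentence L) : (forall i, hsat (M i) sigma) -> hsat uprod sigma.
Proof.
elim: sigma => [x phi psi Msigma a /uprod_sat Fphi|sigma IHs tau IHt Mst] /=.
  apply/uprod_sat; apply: (filterS _ Fphi) => i [b ab bphi].
  by exists b => //; apply: Msigma.
by split; [apply: IHs|apply: IHt] => i; case: (Mst i).
Qed.

End Ultraproduct.

(** * Compactness *)

Section Compactness.
Variables (L : language) (T : htheory L) (x : seq (sort_of L)).

(** Finite lists stand for finite sets of formulas, cut down to [p] so that every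
list is a legitimate index. The factor at [l] realizes [l] restricted to [p],
and along an ultrafilter containing all the sets of lists above a given one,
every formula of [p] holds in almost every factor. *)
Lemma compactness (p : set (pformula x)) :
  (forall l : seq {classic pformula x}, consistent T [set phi | phi \in l /\ p phi]) ->
  consistent T p.
Proof.
move=> pfin.
pose M l := projT1 (cid (pfin l)).
have MT l : models (M l) T by rewrite /M; case: cid => N [].
have Ma l : exists a : tup (M l) x, forall phi, phi \in l -> p phi -> sat phi a.
  by rewrite /M; case: cid => N [_ [a ha]] /=; exists a => phi ? ?; apply: ha.
pose a l := projT1 (cid (Ma l)).
have ap (l : seq {classic pformula x}) phi : phi \in l -> p phi -> sat phi (a l).
  by move=> ? ?; apply: (projT2 (cid (Ma l))).
pose above (l : seq {classic pformula x}) :=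
  [set l' : seq {classic pformula x} | {subset l <= l'}].
have aboveF : ProperFilter (filter_from setT above).
  apply: filter_from_proper => [|l _]; last by exists l => phi.
  apply: filter_fromT_filter; first by exists [::].
  move=> l l'; exists (l ++ l') => k /= lk.
  by split=> phi phil; apply: lk; rewrite mem_cat phil ?orbT.
have [F [UF sF]] := ultraFilterLemma aboveF.
exists (uprod UF M); split=> [sigma Tsigma|].
  by apply: uprod_hsat => l; apply: MT.
have Fv s (v : var x s) : F [set l | exists m, m = a l s v].
  by apply: (filterS _ filterT) => l _; exists (a l s v).
pose c s v := projT1 (cid (near_germ UF (Fv s v))).
have Fc : F [set l | forall s v, value (c s v) l = Some (a l s v)].
  apply: (filter_forall_var _ (A := fun s v => [set l | value (c s v) l = Some (a l s v)])).
  move=> s v; rewrite /c; case: cid => d Fd /=.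
  by apply: (filterS _ Fd) => l /= [m dm <-].
exists c => phi pphi; apply/uprod_sat.
have Fphi : F (above [:: phi]) by apply: sF; exists [:: phi].
apply: (filterS _ (filterI Fc Fphi)) => l [cl phil].
by exists (a l) => //; apply: ap => //; apply: phil; rewrite inE.
Qed.

End Compactness.

(** * Separation of positive types *)

Section Separation.
Variables (L : language) (T : htheory L) (x : seq (sort_of L)).
Implicit Types (p q : ptype T x) (phi psi : pformula x).

(** The witness is the conjunction of the members of [l] that belong to [p]; it
turns a finite part of [p] into one member of [p]. *)
Lemma ptype_finite_conj p (l : seq {classic pformula x}) :
  exists2 psi, basic psi p & forall chi, chi \in l -> basic chi p ->
    forall (M : structure L) (a : tup M x), sat psi a -> sat chi a.
Proof.
elim: l => [|phi l [psi ppsi psil]]; first by exists (PAtom PTop) => //; rewrite basicT.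
have [pphi|nphi] := pselect (basic phi p).
  exists (PAnd phi psi); first by rewrite basicI.
  by move=> chi; rewrite inE => /orP[/eqP ->|/psil h] pchi M a [] // _; apply: h.
by exists psi => // chi; rewrite inE => /orP[/eqP -> //|]; apply: psil.
Qed.

(** Compactness applied to [p] with [phi] added, which is inconsistent by
maximality. *)
Lemma ptype_exclusion p phi : ~ basic phi p ->
  exists2 psi, basic psi p & basic (T := T) phi `&` basic psi = set0.
Proof.
move=> nphi.
have : ~ consistent T (ptype_set p `|` [set phi]).
  move=> con; apply: nphi; have [_ pmax] := ptypeP p.
  by rewrite /basic /= -(pmax _ con (@subsetUl _ _ _)); right.
move=> /(contra_not (@compactness _ _ _ _)) /existsNP[l ncon].
have [psi ppsi psil] := ptype_finite_conj p l.
exists psi => //; apply/seteqP; split=> // q [qphi qpsi]; apply: ncon.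
have [M [MT [a qa]]] := ptype_realized q; exists M; split=> //; exists a => chi.
by move=> [lchi [pchi|->]]; [apply: (psil chi) => //; apply/qa | apply/qa].
Qed.

(** Two positive types are never properly nested, so it is always possible to
choose on which side the separating formula lies. *)
Lemma ptype_neq_basic p q : p <> q -> exists2 phi, basic phi p & ~ basic phi q.
Proof.
move=> pq; apply: contrapT => npq; apply: pq.
have sub : ptype_set p `<=` ptype_set q.
  by move=> phi pphi; apply: contrapT => nq; apply: npq; exists phi.
case: p q sub {npq} => [p pP] [q qP] /= sub.
have := pP.2 q qP.1 sub => qp; subst q.
by congr PType; apply: Prop_irrelevance.
Qed.

Lemma spectral_open_basic phi : spectral_open (basic (T := T) phi).
Proof. by exists [set phi]; rewrite bigcup_set1. Qed.

Lemma spectral_open_setC_basic phi : spectral_open (~` basic (T := T) phi).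
Proof.
exists [set psi | basic (T := T) phi `&` basic psi = set0].
apply/seteqP; split=> p; first by move=> /ptype_exclusion[psi]; exists psi.
by move=> [psi disj ppsi] pphi; rewrite -[False]/(set0 p) -disj.
Qed.

End Separation.

Theorem proposition1p2 (L : language) (T : htheory L) (x : seq (sort_of L)) :
  hausdorff_space (spectral_space T x) /\
  (forall U : set (ptype T x),
     @open (definable_space T x) U -> @open (spectral_space T x) U).
Proof.
split.
  rewrite open_hausdorff => p q /eqP /ptype_neq_basic[phi pphi /ptype_exclusion[psi qpsi disj]].
  exists (basic phi, basic psi); first by rewrite !inE.
  by split; [exact: spectral_open_basic|exact: spectral_open_basic|apply/eqP].
move=> U [D CU]; rewrite -[U]setCK CU setC_bigcap bigcup_mkcond.
apply: spectral_open_bigU => phi; case: ifP => _; first exact: spectral_open_setC_basic.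
by rewrite -(basic0 T x); exact: spectral_open_basic.
Qed.
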